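(* Let $u\in U$ be fixed with $g(u,\boldsymbol m)<0$, let $p=\mathbb P(g(u,\boldsymbol\zeta)\le0)$ and assume $p\in(0,1)$. Set $$\rho^{\inf}:=\inf\{\rho(u,\boldsymbol v):\boldsymbol v\in\mathbb S^{n-1}\},\qquad \rho^{\sup}:=\sup\{\rho(u,\boldsymbol v):\boldsymbol v\in\mathbb S^{n-1}\},\qquad \rho_\delta:=\rho^{\sup}-\rho^{\inf}.$$ Then $$\operatorname{V}_{\mathrm{SRD}}\le \ell^2\rho_\delta^2,$$ where $\ell$ is the maximum of the density $F_\chi'$ of the Chi-distribution with $n$ degrees of freedom on $[0,\infty)$ (which is bounded for any dimension $n$).
   Context: $U$ is a Banach space, $g:U\times\mathbb R^n\to\mathbb R$ is such that $g(u,\cdot)$ is convex for every $u\in U$, and $\boldsymbol\zeta\sim\mathcal N(\boldsymbol m,\Sigma)$ is a nondegenerate $n$-dimensional Gaussian random vector. $L\in\mathbb R^{n\times n}$ satisfies $LL^T=\Sigma$. $\mathbb S^{n-1}$ is the Euclidean unit sphere of $\mathbb R^n$. For $u$ with $g(u,\boldsymbol m)<0$ and $\boldsymbol v\in\mathbb S^{n-1}$, $$\rho(u,\boldsymbol v):=\sup\{r\ge0:g(u,\boldsymbol m+rL\boldsymbol v)\le0\}\in[0,\infty].$$ $F_\chi$ is the (cumulative) distribution function of the one-dimensional Chi-distribution with $n$ degrees of freedom, with the convention $F_\chi(\infty)=1$. With $\boldsymbol\theta$ uniformly distributed on $\mathbb S^{n-1}$, $$\operatorname{V}_{\mathrm{SRD}}:=\operatorname{Var}F_\chi(\rho(u,\boldsymbol\theta))$$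 is the variance of the elementary spherical-radial estimator of $p$. It is a known fact (spherical-radial decomposition) that $p=\mathbb P(g(u,\boldsymbol\zeta)\le0)=\mathbb E F_\chi(\rho(u,\boldsymbol\theta))$. If $\rho^{\sup}=\infty$, then $\rho_\delta=\infty$ and the asserted bound is understood to hold trivially. *)

(* Defs.v *)
From HB Require Import structures.
From mathcomp Require Import all_boot all_order all_algebra.
From mathcomp Require Import all_classical all_reals all_analysis.

Set Implicit Arguments.
Unset Strict Implicit.
Unset Printing Implicit Defensive.

Import Order.TTheory GRing.Theory Num.Theory.
Import numFieldNormedType.Exports.

Local Open Scope classical_set_scope.
Local Open Scope ring_scope.

Definition dotv (R : realType) (n : nat) (a b : 'cV[R]_n) : R :=
  \sum_(i < n) a i 0 * b i 0.

(* The library norm on matrices is the sup norm. *)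
Definition enorm (R : realType) (n : nat) (v : 'cV[R]_n) : R :=
  Num.sqrt (dotv v v).

Definition sphere (R : realType) (n : nat) : set 'cV[R]_n :=
  [set v | enorm v = 1].
Arguments sphere : clear implicits.

(* R^n with its Borel sigma-algebra. *)
Definition borelcV (R : realType) (n : nat) :=
  g_sigma_algebraType (@open 'cV[R]_n).

Definition posdef (R : realType) (n : nat) (S : 'M[R]_n) : Prop :=
  S^T = S /\ forall a : 'cV[R]_n, a != 0 -> 0 < dotv a (S *m a).

(* X ~ N(m, S) with S positive definite: every nontrivial linear functional
   <a, X> is normal with mean <a, m> and variance <a, S a>. The second
   parameter of [normal_prob] is the standard deviation. *)
Definition nondegenerate_gaussian (R : realType) (n : nat)
    (d : measure_display) (Omega : measurableType d) (P : probability Omega R)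
    (X : {RV P >-> borelcV R n}) (m : 'cV[R]_n) (S : 'M[R]_n) : Prop :=
  posdef S /\
  forall a : 'cV[R]_n, a != 0 ->
  forall B : set R, measurable B ->
    P [set w | B (dotv a (X w))] =
    normal_prob (dotv a m) (Num.sqrt (dotv a (S *m a))) B.

(* The uniform distribution on the sphere is the unique Borel probability
   measure on it that is invariant under the orthogonal group. *)
Definition uniform_on_sphere (R : realType) (n : nat)
    (d : measure_display) (Omega : measurableType d) (P : probability Omega R)
    (X : {RV P >-> borelcV R n}) : Prop :=
  (forall w, sphere R n (X w)) /\
  forall Q : 'M[R]_n, Q^T *m Q = 1%:M ->
  forall A : set (borelcV R n), measurable A ->
    P [set w | A (Q *m (X w : 'cV[R]_n))] = P [set w | A (X w)].

Definition Gamma (R : realType) (a : R) : R :=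
  Rintegral (@lebesgue_measure R) `]0, +oo[
    (fun t => t `^ (a - 1) * expR (- t)).

(* Density of the chi distribution with n degrees of freedom; at 0 it takes the
   value of the right limit, so for n = 1 it is the right derivative of the
   distribution function there. *)
Definition chi_pdf (R : realType) (n : nat) (x : R) : R :=
  if 0 <= x then
    x ^+ n.-1 * expR (- (x ^+ 2 / 2)) /
      (2 `^ (n%:R / 2 - 1) * Gamma (n%:R / 2))
  else 0.

Definition chi_cdf (R : realType) (n : nat) (x : \bar R) : R :=
  match x with
  | r%:E => Rintegral (@lebesgue_measure R) `]-oo, r] (chi_pdf n)
  | +oo%E => 1
  | -oo%E => 0
  end.

Section rho.
Variables (R : realType) (n : nat) (U : Type) (g : U -> 'cV[R]_n -> R).
Variables (m : 'cV[R]_n) (L : 'M[R]_n) (u : U).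
Local Open Scope ereal_scope.

Definition rho (v : 'cV[R]_n) : \bar R :=
  ereal_sup [set r%:E | r in
    [set r : R | (0 <= r)%R /\ (g u (m + r *: (L *m v)) <= 0)%R]].

Definition rho_inf : \bar R := ereal_inf [set rho v | v in sphere R n].

Definition rho_sup : \bar R := ereal_sup [set rho v | v in sphere R n].

(* In the library +oo - +oo = -oo, hence the case distinction. *)
Definition rho_delta : \bar R :=
  if rho_sup == +oo then +oo else rho_sup - rho_inf.

End rho.

(* Main.v *)
(* The random variable F_chi(rho(u, theta)) takes its values in the interval
   [F_chi(rho_inf), F_chi(rho_sup)], whose length is at most l * rho_delta because
   F_chi' <= l, and the variance of a random variable is at most the squared
   length of an interval containing its values. The density is proportional to
   x ^ (n - 1) * exp (- x ^ 2 / 2) and attains its maximum at sqrt (n - 1); for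
   rho_sup = +oo one also needs l > 0, i.e. that Gamma (n / 2) is finite. *)
Require Import Defs.
From HB Require Import structures.
From mathcomp Require Import all_boot all_order all_algebra.
From mathcomp Require Import all_classical all_reals all_analysis.
From mathcomp Require Import measurable_realfun ring lra.

Import Order.TTheory GRing.Theory Num.Theory.
Import numFieldNormedType.Exports.

Local Open Scope classical_set_scope.
Local Open Scope ring_scope.

(** * Monotone integrals and the variance of a bounded variable *)

(* The integral of a nonnegative function is the supremum of the integrals of the
   simple functions below it, hence monotone without measurability. *)
Lemma le_ge0_integral d (T : measurableType d) (R : realType)
    (mu : {measure set T -> \bar R}) (f g : T -> \bar R) :
  (forall x, 0 <= f x)%E -> (forall x, f x <= g x)%E ->
  (\int[mu]_x f x <= \int[mu]_x g x)%E.
Proof.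
move=> f0 fg; have g0 x : (0 <= g x)%E := le_trans (f0 x) (fg x).
rewrite !ge0_integralTE//; apply: ereal_sup_le => _ [h hf <-].
by exists h => // x; exact: le_trans (hf x) (fg x).
Qed.

(** The mean also lies in [[a, b]], so every deviation is at most [b - a]. As [X] is not assumed
    measurable, [0 <= a] serves to make [le_ge0_integral] applicable. *)
Lemma variance_le_sqr_range d (T : measurableType d) (R : realType)
    (P : probability T R) (X : T -> R) (a b : R) :
  0 <= a -> (forall w, a <= X w <= b) -> ('V_P[X] <= ((b - a) ^+ 2)%:E)%E.
Proof.
move=> a0 Xab.
have cstE (r : R) : (\int[P]_x r%:E = r%:E)%E.
  rewrite -[RHS]mule1 -[X in (_ * X)%E](probability_setT P).
  exact: integral_cst.
have aE : (a%:E <= 'E_P[X])%E.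
  rewrite unlock -[leLHS]cstE; apply: le_ge0_integral => w; first by [].
  by rewrite lee_fin; case/andP: (Xab w).
have Eb : ('E_P[X] <= b%:E)%E.
  rewrite unlock -[leRHS]cstE; apply: le_ge0_integral => w; rewrite lee_fin.
    by apply: le_trans a0 _; case/andP: (Xab w).
  by case/andP: (Xab w).
move: aE Eb; rewrite /variance covariance.unlock; case: ('E_P[X])%E => [e||]//.
rewrite !lee_fin expectation.unlock /= => ae eb.
rewrite -cstE; apply: le_ge0_integral => w; rewrite lee_fin /=.
  by rewrite -expr2 sqr_ge0.
move: (Xab w) => /andP[aX Xb]; rewrite fctE /=.
(* Both factors are nonnegative and their product is [(b - a) ^+ 2 - (X w - e) ^+ 2]. *)
have := @mulr_ge0 _ (b - a - (X w - e)) (b - a + (X w - e)).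
by move=> H; rewrite -subr_ge0; have := H ltac:(lra) ltac:(lra); lra.
Qed.

(** * Finiteness and positivity of the Gamma function *)

Lemma is_derive_ratio_powR (R : realType) (a x : R) : 0 < x ->
  is_derive x (1 : R) (fun t : R => (t / (1 + t)) `^ a)
    (a * (x / (1 + x)) `^ (a - 1) / (1 + x) ^+ 2).
Proof.
move=> x0; have x1 : 1 + x != 0 by rewrite gt_eqF// addr_gt0.
have xx : 0 < x / (1 + x) by rewrite divr_gt0// addr_gt0.
have dr : is_derive x (1 : R) (fun t : R => t / (1 + t)) (((1 + x) ^+ 2)^-1).
  have dV := @is_deriveV R (fun t : R => 1 + t) x (0 + 1) 1 x1 (is_deriveD _ _).
  have dM := is_deriveM (is_derive_id x 1) (dV _ _).
  apply: (is_derive_eq (dM _ _)).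
  by rewrite /GRing.scale /=; field.
have := @is_derive1_comp R (@powR R ^~ a) (fun t => t / (1 + t)) x _ _
  (@is_derive1_powR R a _ xx) dr.
exact.
Qed.

Lemma continuous_ratio_powR (R : realType) (a x : R) : 0 < x ->
  {for x, continuous (fun t : R => (t / (1 + t)) `^ (a - 1) / (1 + t) ^+ 2)}.
Proof.
move=> x0; have x1 : 1 + x != 0 by rewrite gt_eqF// addr_gt0.
apply: continuousM.
  apply/differentiable_continuous/derivable1_diffP.
  by have [] := is_derive_ratio_powR R (a - 1) x x0.
apply: continuousV; first by rewrite expf_neq0.
apply: (@continuous_comp _ _ _ (fun t : R => 1 + t) (fun t : R => t ^+ 2)).
  by apply: continuousD; [exact: cvg_cst|exact: cvg_id].
exact: exprn_continuous.
Qed.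

(* The right-hand side is, up to a constant factor, the derivative of the bounded
   function [t |-> (t / (1 + t)) ^ a]. *)
Lemma Gamma_integrand_le (R : realType) (a t : R) : 0 < a -> 0 < t ->
  t `^ (a - 1) * expR (- t) <=
  expR 1 * (a + 1) `^ (a + 1) * ((t / (1 + t)) `^ (a - 1) / (1 + t) ^+ 2).
Proof.
move=> a0 t0; have b0 : 0 < a + 1 by rewrite addr_gt0.
have t1 : 0 < 1 + t by rewrite addr_gt0.
(* Exponential form of [ln z <= z] at [z = (1 + t) / (a + 1)], multiplied by [a + 1]. *)
have key : (1 + t) `^ (a + 1) <= expR 1 * (a + 1) `^ (a + 1) * expR t.
  rewrite /powR !gt_eqF// mulrAC -!expRD ler_expR.
  have : ln ((1 + t) / (a + 1)) <= (1 + t) / (a + 1).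
    by rewrite ltW// ln_sublinear// divr_gt0.
  rewrite ln_div ?posrE// ler_pdivlMr// mulrBl.
  by rewrite [ln (1 + t) * _]mulrC [ln (a + 1) * _]mulrC; lra.
have -> : t `^ (a - 1) = (t / (1 + t)) `^ (a - 1) * (1 + t) `^ (a - 1).
  by rewrite -powRM ?divr_ge0 ?ltW// divfK// gt_eqF.
rewrite -mulrA [leRHS]mulrCA ler_wpM2l ?powR_ge0//.
rewrite expRN ler_pdivrMr ?expR_gt0// mulrAC ler_pdivlMr ?exprn_gt0//.
apply: le_trans key; rewrite -powR_mulrn ?(ltW t1)// -powRD; last first.
  by rewrite (gt_eqF t1) implybT.
by rewrite (_ : a - 1 + 2 = a + 1)//; lra.
Qed.

(** Exhaustion by compact intervals away from 0, where the fundamental theorem of calculus is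
    available; the first one is the single point 1. *)
Lemma itv0y_bigcup (R : realType) :
  `]0 : R, +oo[%classic = \bigcup_n `[n.+1%:R^-1, n.+1%:R]%classic.
Proof.
apply/seteqP; split => x /=.
  rewrite in_itv/= andbT => x0.
  exists (maxn (Num.truncn x) (Num.truncn x^-1)) => //=.
  rewrite in_itv/=; apply/andP; split.
    rewrite invf_ple ?posrE//; apply/ltW/(lt_le_trans (truncnS_gt _)).
    by rewrite ler_nat ltnS leq_maxr.
  by apply/ltW/(lt_le_trans (truncnS_gt _)); rewrite ler_nat ltnS leq_maxl.
move=> [n _] /=; rewrite !in_itv/= andbT => /andP[+ _]; apply: lt_le_trans.
by rewrite invr_gt0.
Qed.

Lemma measurable_Gamma_integrand (R : realType) (a : R) (D : set R) :
  measurable_fun D (EFin \o (fun t : R => t `^ (a - 1) * expR (- t))).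
Proof.
apply: measurable_funTS; apply/measurable_EFinP; apply: measurable_funM.
  exact: measurable_powR.
exact: measurableT_comp.
Qed.

(** The majorant has a primitive with values in [[0, K / a]] on the positive reals, so the integrals
    over the exhausting intervals are at most [K / a], and so is their limit. *)
Lemma Gamma_integral_lty (R : realType) (a : R) : 0 < a ->
  (\int[lebesgue_measure]_(t in `]0%R, +oo[) (t `^ (a - 1) * expR (- t))%:E
     < +oo)%E.
Proof.
move=> a0.
set K := expR 1 * (a + 1) `^ (a + 1).
have K0 : 0 <= K by rewrite mulr_ge0 ?expR_ge0 ?powR_ge0.
have mf := measurable_Gamma_integrand R a.
have f0 (t : R) : (0 <= (t `^ (a - 1) * expR (- t))%:E)%E.
  by rewrite lee_fin mulr_ge0 ?powR_ge0 ?expR_ge0.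
suff : (\int[lebesgue_measure]_(t in `]0%R, +oo[)
    (t `^ (a - 1) * expR (- t))%:E <= (K / a)%:E)%E.
  by move/le_lt_trans; apply; rewrite ltry.
rewrite itv0y_bigcup.
have ndF : {homo (fun n => `[(n.+1%:R)^-1, n.+1%:R]%classic : set R) :
    n m / (n <= m)%N >-> (n <= m)%O}.
  move=> n m nm; apply/subsetPset; apply: subset_itv; rewrite bnd_simp.
    by rewrite lef_pV2 ?posrE// ler_nat.
  by rewrite ler_nat.
apply: (cvge_le _ (@ge0_nondecreasing_set_cvg_integral _ _ _ _ _
  lebesgue_measure ndF _ _ _)) => //; last by move=> i; exact: mf.
apply: nearW => n; pose x : R := n.+1%:R^-1; pose y : R := n.+1%:R.
rewrite -/x -/y.
(* [g] behaves like [t ^ (a - 1)] near 0 and like [t ^ (-2)] at infinity. In its primitive [G], the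
   factor [1 / a] cancels the one from differentiating the power. *)
pose g (t : R) := (t / (1 + t)) `^ (a - 1) / (1 + t) ^+ 2.
pose G (t : R) := K / a * (t / (1 + t)) `^ a.
have x0 : 0 < x by rewrite invr_gt0.
have xy : x <= y by rewrite (@le_trans _ _ 1)// ?invf_le1// ler1n.
have dG (t : R) : 0 < t -> is_derive t (1 : R) G (K * g t).
  move=> t0; have dF := is_derive_ratio_powR R a t t0.
  apply: (is_derive_eq (is_deriveZ (K / a) dF)).
  by rewrite /GRing.scale /g /=; field; rewrite !gt_eqF// addr_gt0.
have cG (t : R) : 0 < t -> {for t, continuous G}.
  move=> t0; apply/differentiable_continuous/derivable1_diffP.
  by have [] := dG t t0.
have cKg (t : R) : 0 < t -> {for t, continuous (fun t => K * g t)}.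
  move=> t0; apply: continuousM; first exact: cvg_cst.
  exact: continuous_ratio_powR.
have cg : {within `[x, y], continuous (fun t => K * g t)}.
  apply: continuous_in_subspaceT => t; rewrite inE/= in_itv/= => /andP[xt _].
  exact/cKg/(lt_le_trans x0).
(* Equality occurs for [n = 0]; [continuous_FTC2] needs [x < y]. *)
have [xyE|xNy] := eqVneq x y.
  by rewrite -xyE set_itv1 integral_set1 lee_fin divr_ge0// ltW.
apply: (@le_trans _ _ (\int[lebesgue_measure]_(t in `[x, y]) (K * g t)%:E)%E).
  apply: ge0_le_integral => //; first exact: mf.
    by apply/measurable_EFinP; apply: subspace_continuous_measurable_fun.
  move=> t /=; rewrite in_itv/= => /andP[xt _].
  by rewrite lee_fin; exact/Gamma_integrand_le/(lt_le_trans x0).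
rewrite (@continuous_FTC2 _ _ G) ?lt_neqAle ?xNy//; last 2 first.
- split => [t||].
  + by rewrite in_itv/= => /andP[xt _]; have [] := dG t (lt_trans x0 xt).
  + exact/cvg_at_right_filter/cG.
  + exact/cvg_at_left_filter/cG/(lt_le_trans x0).
- move=> t; rewrite in_itv/= => /andP[xt _].
  by rewrite derive1E; have [_ ->] := dG t (lt_trans x0 xt).
have y0 := lt_le_trans x0 xy.
have Gx : 0 <= G x by rewrite mulr_ge0 ?powR_ge0// divr_ge0// ltW.
have Gy : G y <= K / a.
  rewrite ler_piMr ?divr_ge0 ?(ltW a0)//.
  have y1 : 0 < 1 + y by rewrite addr_gt0.
  apply: (@le_trans _ _ ((1 : R) `^ a)); last by rewrite powR1.
  rewrite ge0_ler_powR ?nnegrE ?divr_ge0 ?(ltW a0) ?(ltW y0) ?(ltW y1)//.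
  by rewrite ler_pdivrMr// mul1r lerDr.
by rewrite lee_fin; lra.
Qed.

Lemma integral_cst_itv (R : realType) (b0 b1 : bool) (x y c : R) : x <= y ->
  (\int[lebesgue_measure]_(t in [set` Interval (BSide b0 x) (BSide b1 y)]) c%:E
     = (c * (y - x))%:E)%E.
Proof.
move=> xy; have muE : lebesgue_measure
    ([set` Interval (BSide b0 x) (BSide b1 y)] : set R) = (y - x)%:E.
  rewrite lebesgue_measure_itv/= lte_fin; case: ltP => // yx.
  by rewrite (@le_anti _ _ x y) ?xy// subrr.
by rewrite EFinM -muE; exact: integral_cst.
Qed.

(** [Gamma] is a [fine] value, which would be 0 for an infinite integral: finiteness is needed
    besides a positive lower bound, taken from [[1, 2]]. *)
Lemma Gamma_gt0 (R : realType) (a : R) : 0 < a -> 0 < Gamma a.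
Proof.
move=> a0; rewrite /Gamma /Rintegral.
have mf := measurable_Gamma_integrand R a.
have f0 (t : R) : (0 <= (t `^ (a - 1) * expR (- t))%:E)%E.
  by rewrite lee_fin mulr_ge0 ?powR_ge0 ?expR_ge0.
apply: fine_gt0; rewrite Gamma_integral_lty// andbT.
apply: (@lt_le_trans _ _ (\int[lebesgue_measure]_(t in `[1%R, 2%R])
    (2^-1 * expR (- 2))%:E)%E).
  by rewrite integral_cst_itv ?ler1n.
apply: (@le_trans _ _ (\int[lebesgue_measure]_(t in `[1%R, 2%R])
    (t `^ (a - 1) * expR (- t))%:E)%E).
  apply: ge0_le_integral => //; last 2 first.
  - exact: mf.
  - move=> t; rewrite /= in_itv/= => /andP[t1 t2].
    rewrite lee_fin ler_pM ?expR_ge0//; last by rewrite ler_expR lerN2.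
    (* As [-1 < a - 1] and [1 <= t <= 2], the power is at least [1 / t], hence at least [1 / 2]. *)
    apply: (@le_trans _ _ (t `^ (- 1))).
      by rewrite powR_inv1 ?lef_pV2 ?posrE ?(le_trans _ t1)// (lt_le_trans _ t1).
    by rewrite ler_powR//; lra.
apply: ge0_subset_integral => //; first exact: mf.
by move=> t /=; rewrite !in_itv/= andbT => /andP[t1 _]; exact: lt_le_trans t1.
Qed.

(** * The chi density and the increments of its distribution function *)

Lemma chi_norm_gt0 (R : realType) (n : nat) : (0 < n)%N ->
  0 < 2 `^ (n%:R / 2 - 1) * Gamma (n%:R / 2) :> R.
Proof.
by move=> n0; rewrite mulr_gt0 ?powR_gt0// Gamma_gt0// divr_gt0// ltr0n.
Qed.

Lemma chi_pdf_ge0 (R : realType) (n : nat) (x : R) : (0 < n)%N ->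
  0 <= chi_pdf n x.
Proof.
move=> n0; rewrite /chi_pdf; case: ifPn => // x0.
by rewrite divr_ge0 ?(ltW (chi_norm_gt0 _ _ n0))// mulr_ge0 ?exprn_ge0 ?expR_ge0.
Qed.

Lemma chi_pdf_gt0 (R : realType) (n : nat) (x : R) : (0 < n)%N -> 0 < x ->
  0 < chi_pdf n x.
Proof.
move=> n0 x0; rewrite /chi_pdf ltW//.
by rewrite divr_gt0 ?chi_norm_gt0// mulr_gt0 ?exprn_gt0 ?expR_gt0.
Qed.

(* The square of the claim is [y ^ k <= exp (k (y - 1))] for [y = x ^ 2 / k]. *)
Lemma exprn_gauss_le (R : realType) (k : nat) (x : R) : 0 <= x ->
  x ^+ k * expR (- (x ^+ 2 / 2)) <=
  Num.sqrt k%:R ^+ k * expR (- (Num.sqrt k%:R ^+ 2 / 2)).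
Proof.
move=> x0; rewrite sqr_sqrtr ?ler0n//; case: k => [|k].
  by rewrite !expr0 !mul1r ler_expR lerN2 mul0r divr_ge0// exprn_ge0.
set K : R := k.+1%:R; have K0 : 0 < K by rewrite ltr0n.
have y_le : x ^+ 2 / K <= expR (x ^+ 2 / K - 1).
  by have := expR_ge1Dx (x ^+ 2 / K - 1); rewrite addrC subrK.
have sq : x ^+ 2 ^+ k.+1 <= K ^+ k.+1 * expR (x ^+ 2 - K).
  have := lerXn2r k.+1 _ _ y_le; rewrite !nnegrE divr_ge0 ?exprn_ge0 ?(ltW K0)//.
  rewrite expR_ge0 => /(_ isT isT); rewrite expr_div_n ler_pdivrMr ?exprn_gt0//.
  rewrite -expRM_natl mulrC => /le_trans; apply.
  by rewrite mulrBr mulr1 mulrCA divff ?gt_eqF// mulr1.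
rewrite -(@ler_pXn2r _ 2)// ?nnegrE ?mulr_ge0 ?exprn_ge0 ?expR_ge0 ?sqrtr_ge0//.
rewrite !exprMn -!exprM ![(k.+1 * 2)%N]mulnC !exprM sqr_sqrtr ?(ltW K0)//.
rewrite -!expRM_natl !mulrN !(mulrC 2) !divfK//.
by rewrite expRN ler_pdivrMr ?expR_gt0// -mulrA -expRD addrC.
Qed.

Lemma chi_pdf_le_max (R : realType) (n : nat) (x : R) : (0 < n)%N -> 0 <= x ->
  chi_pdf n x <= chi_pdf n (Num.sqrt n.-1%:R).
Proof.
move=> n0 x0; rewrite /chi_pdf x0 sqrtr_ge0.
by rewrite ler_pM2r ?invr_gt0 ?chi_norm_gt0// exprn_gauss_le.
Qed.

Lemma measurable_chi_pdf (R : realType) (n : nat) (D : set R) :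
  measurable_fun D (@chi_pdf R n).
Proof.
apply: measurable_funTS; apply: measurable_fun_ifT => //.
  exact: measurable_fun_ler.
apply: measurable_funM => //; apply: measurable_funM.
  exact: exprn_measurable.
apply: measurableT_comp => //; apply: measurableT_comp => //.
by apply: measurable_funM => //; exact: exprn_measurable.
Qed.

(** The density vanishes on the negative reals and is at most [l] on [[0, y]], so its integral is at
    most [l * y]. *)
Lemma integrable_chi_pdf (R : realType) (n : nat) (y : R) :
  (0 < n)%N -> 0 <= y ->
  lebesgue_measure.-integrable `]-oo, y] (EFin \o @chi_pdf R n).
Proof.
move=> n0 y0; set l : R := chi_pdf n (Num.sqrt n.-1%:R).
apply/integrableP; split.
  by apply/measurable_EFinP; exact: measurable_chi_pdf.
apply: (@le_lt_trans _ _
  (\int[lebesgue_measure]_(t in `[0%R : R, y]) l%:E)%E); last first.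
  by rewrite integral_cst_itv// ltry.
(* Extension by 0 reduces the two domains to a pointwise comparison on the whole line. *)
rewrite integral_mkcond [leRHS]integral_mkcond.
have l0 : 0 <= l by exact: chi_pdf_ge0.
apply: le_ge0_integral => t; rewrite !patchE.
  by case: ifP => // _; rewrite abse_ge0.
case: ifPn => [|_]; last by case: ifP => // _; rewrite lee_fin.
rewrite inE/= in_itv/= => ty; have [t0|t0] := leP 0 t.
  rewrite ifT; last by rewrite inE/= in_itv/= t0.
  by rewrite lee_fin ger0_norm ?chi_pdf_ge0// chi_pdf_le_max.
rewrite (_ : chi_pdf n t = 0); last by rewrite /chi_pdf leNgt t0.
by rewrite normr0; case: ifP => // _; rewrite lee_fin.
Qed.

(** The increment is the integral over []x, y]] of a density between 0 and [l]. The lower bound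
    expresses monotonicity, the upper one the Lipschitz estimate. *)
Lemma chi_cdfB_itv (R : realType) (n : nat) (l x y : R) : (0 < n)%N ->
  (forall r : R, 0 <= r -> chi_pdf n r <= l) -> 0 <= x -> x <= y ->
  0 <= chi_cdf n y%:E - chi_cdf n x%:E <= l * (y - x).
Proof.
move=> n0 chil x0 xy; have y0 := le_trans x0 xy.
have ichi := integrable_chi_pdf R n y n0 y0.
rewrite /chi_cdf Rintegral_itvB//.
apply/andP; split.
  by apply: Rintegral_ge0 => t _; exact: chi_pdf_ge0.
have <- : \int[lebesgue_measure]_(t in `]x, y]) l = l * (y - x).
  by rewrite /Rintegral integral_cst_itv.
apply: le_Rintegral => //.
- by apply: integrableS ichi => //; apply: subset_itvr.
- apply/integrableP; split; first exact: measurable_cst.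
  by rewrite integral_cst_itv// ltry.
- move=> t /=; rewrite in_itv/= => /andP[xt _].
  exact/chil/(le_trans x0)/ltW.
Qed.

(** * The radial function and the variance bound *)

Lemma rho_ge0 (R : realType) (n : nat) (U : Type) (g : U -> 'cV[R]_n -> R)
    (m : 'cV[R]_n) (L : 'M[R]_n) (u : U) (v : 'cV[R]_n) :
  g u m <= 0 -> (0 <= rho g m L u v)%E.
Proof.
(* The radius 0 is admissible, since it gives the point [m]. *)
by move=> gum; apply: ereal_sup_ubound; exists 0 => //=; rewrite scale0r addr0.
Qed.

Theorem lemma3p3 (R : realType) (n : nat) (n_gt0 : (0 < n)%N)
    (U : completeNormedModType R) (g : U -> 'cV[R]_n -> R)
    (g_convex : forall u : U, convex_function [set: 'cV[R]_n] (g u))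
    (d : measure_display) (Omega : measurableType d) (P : probability Omega R)
    (m : 'cV[R]_n) (Sigma L : 'M[R]_n) (LLT : L *m L^T = Sigma)
    (zeta : {RV P >-> borelcV R n})
    (zeta_gaussian : nondegenerate_gaussian zeta m Sigma)
    (theta : {RV P >-> borelcV R n}) (theta_unif : uniform_on_sphere theta)
    (u : U) (gum_lt0 : g u m < 0)
    (p_itv : (0 < P [set w | (g u (zeta w) <= 0)%R] < 1)%E) :
  exists l : R,
    [/\ exists2 r : R, 0 <= r & chi_pdf n r = l,
        forall r : R, 0 <= r -> chi_pdf n r <= l
      & ('V_P[fun w => chi_cdf n (rho g m L u (theta w))] <=
           (l ^+ 2)%:E * rho_delta g m L u ^+ 2)%E ].
Proof.
set l : R := chi_pdf n (Num.sqrt n.-1%:R).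
have chil (r : R) : 0 <= r -> chi_pdf n r <= l by exact: chi_pdf_le_max.
have l_gt0 : 0 < l.
  by apply: lt_le_trans (chil 1 _); rewrite ?chi_pdf_gt0.
exists l; split => //; first by exists (Num.sqrt n.-1%:R).
rewrite /rho_delta; case: ifPn => [_|sup_fin].
  (* Since [0 < l], the right-hand side is [+oo]; for [l = 0] the product would be 0. *)
  by rewrite expe2 mulyy gt0_muley ?lte_fin ?exprn_gt0// leey.
have [theta_sphere _] := theta_unif.
have le_sup w : (rho g m L u (theta w) <= rho_sup g m L u)%E.
  by apply: ereal_sup_ubound; exists (theta w).
have inf_le w : (rho_inf g m L u <= rho g m L u (theta w))%E.
  by apply: ereal_inf_lbound; exists (theta w).
have inf_ge0 : (0 <= rho_inf g m L u)%E.
  by apply: le_ereal_inf_tmp => _ [v _ <-]; apply: rho_ge0; exact: ltW.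
(* Any sample point gives [rho_inf <= rho_sup]; with [0 <= rho_inf] and [rho_sup] different from
   [+oo], both are real. *)
have := le_trans (inf_le point) (le_sup point).
move: sup_fin inf_ge0 le_sup inf_le.
case: (rho_sup g m L u) => [s||] //; case: (rho_inf g m L u) => [i||] // _.
rewrite lee_fin => i0 le_s i_le; rewrite lee_fin => is_.
apply: (@le_trans _ _ ((chi_cdf n s%:E - chi_cdf n i%:E) ^+ 2)%:E).
  apply: variance_le_sqr_range => [|w].
    by apply: Rintegral_ge0 => t _; exact: chi_pdf_ge0.
  move: (le_s w) (i_le w); case: (rho g m L u (theta w)) => [r||] //.
  rewrite !lee_fin => rs ir.
  (* Monotonicity on [[i, r]] and [[r, s]] encloses the value at [r]. *)
  have /andP[+ _] := chi_cdfB_itv R n l i r n_gt0 chil i0 ir.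
  have /andP[+ _] := chi_cdfB_itv R n l r s n_gt0 chil (le_trans i0 ir) rs.
  by rewrite !subr_ge0 => -> ->.
(* The Lipschitz estimate on [[i, s]]; the lower bound allows it to be squared. *)
have /andP[F_ge0 F_le] := chi_cdfB_itv R n l i s n_gt0 chil i0 is_.
rewrite -EFinB -EFin_expe -EFinM lee_fin -exprMn lerXn2r// nnegrE.
by rewrite mulr_ge0 ?subr_ge0// ltW.
Qed.
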